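(* Let $N\ge 2$ and $R>0$. Let $\alpha=(\alpha_1,\dots,\alpha_N)$ with $\alpha_i>0$ for all $i$, and let $\mathrm{Rect}(\alpha)=\prod_{i=1}^N(-\alpha_i^{-1}R,\alpha_i^{-1}R)$ and $Q_{2R}=(-R,R)^N$. If $|\mathrm{Rect}(\alpha)|=|Q_{2R}|$ (equivalently $\prod_{i=1}^N\alpha_i=1$), then $$\mu_1^+(\mathrm{Rect}(\alpha))\le \mu_1^+(Q_{2R}).$$ That is, the cube has the largest $\mu_1^+$ among rectangles with a given measure.
   Context: For a symmetric real $N\times N$ matrix $X$, $\mathcal{P}^+_1(X)=\lambda_N(X)$ denotes its largest eigenvalue. For a bounded domain $\Omega\subset\mathbb{R}^N$, the principal eigenvalue of $\mathcal{P}^+_1$ in $\Omega$ is $$\mu_1^+(\Omega)=\sup\{\mu\in\mathbb{R} : \exists\, \phi>0 \text{ in } \Omega,\ \mathcal{P}^+_1(D^2\phi)+\mu\phi\le 0 \text{ in }\Omega\},$$ where $\phi$ is lower semicontinuous and the inequality is understood in the viscosity sense. $|\cdot|$ denotes Lebesgue measure in $\mathbb{R}^N$. *)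

(* Defs.v *)
From HB Require Import structures.
From mathcomp Require Import all_boot all_order all_algebra.
From mathcomp Require Import all_classical all_reals all_analysis.

Set Implicit Arguments.
Unset Strict Implicit.
Unset Printing Implicit Defensive.

Import Order.TTheory GRing.Theory Num.Theory.
Import numFieldNormedType.Exports.

Local Open Scope classical_set_scope.
Local Open Scope ring_scope.

(* R^N is 'rV[R]_N. Its library norm is the sup norm; only the induced
   topology and directional derivatives are used below, and these do not
   depend on the choice of norm. *)

Section truncated_laplacian.
Context {R : realType} {N : nat}.
Implicit Types (X : 'M[R]_N) (Omega : set 'rV[R]_N) (phi psi : 'rV[R]_N -> R).

(* Intended for symmetric X and N > 0, where the set of real eigenvalues is
   finite and nonempty, so that sup is a maximum. *)
Definition P1plus X : R := sup [set a : R | eigenvalue X a].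

Definition basis_vec (i : 'I_N) : 'rV[R]_N := delta_mx 0 i.

Definition partial (i : 'I_N) psi : 'rV[R]_N -> R := 'D_(basis_vec i) psi.

Definition hessian psi (x : 'rV[R]_N) : 'M[R]_N :=
  \matrix_(i, j) partial i (partial j psi) x.

Definition C2_on Omega psi : Prop := forall x, Omega x ->
  {for x, continuous psi} /\
  forall j, [/\ derivable psi x (basis_vec j),
                {for x, continuous (partial j psi)} &
                forall i, derivable (partial j psi) x (basis_vec i) /\
                          {for x, continuous (partial i (partial j psi))}].

(* P1plus (D^2 phi) + mu * phi <= 0 in the open set Omega, in the viscosity
   sense: psi touches phi from below at x0, up to an additive constant. *)
Definition viscosity_supersol Omega (mu : R) phi : Prop :=
  forall psi x0, C2_on Omega psi -> Omega x0 ->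
    (\forall y \near x0, phi x0 - psi x0 <= phi y - psi y) ->
    P1plus (hessian psi x0) + mu * phi x0 <= 0.

(* The values of phi outside Omega are irrelevant; semicontinuity is with
   respect to the topology restricted to Omega. *)
Definition admissible Omega (mu : R) : Prop :=
  exists phi : 'rV[R]_N -> R,
    [/\ lower_semicontinuous (EFin \o phi : subspace Omega -> \bar R),
        forall x, Omega x -> 0 < phi x &
        viscosity_supersol Omega mu phi].

Definition mu1plus Omega : \bar R :=
  ereal_sup [set mu%:E | mu in [set mu : R | admissible Omega mu]].

Definition Rect (r : R) (alpha : 'I_N -> R) : set 'rV[R]_N :=
  [set x | forall i, - ((alpha i)^-1 * r) < x 0 i < (alpha i)^-1 * r].

Definition Cube (r : R) : set 'rV[R]_N := [set x | forall i, - r < x 0 i < r].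

End truncated_laplacian.

Section lebesgue_measure_rV.
Context {R : realType}.

(* N-dimensional Lebesgue measure as the N-fold product of the one-dimensional
   one, transported from R * n.-tuple R to n.+1.-tuple R. *)
Fixpoint lebesgue_tuple (n : nat) : set (n.-tuple R) -> \bar R :=
  match n with
  | 0 => \d_([tuple] : 0.-tuple R)
  | n'.+1 => pushforward (lebesgue_measure \x @lebesgue_tuple n')%E
               (fun p : R * n'.-tuple R => [tuple of p.1 :: p.2])
  end.

Definition lebesgue_rV (n : nat) (A : set 'rV[R]_n) : \bar R :=
  lebesgue_tuple [set t | A (\row_i tnth t i)].

End lebesgue_measure_rV.

(* Main.v *)
Require Import Defs.
From mathcomp Require Import all_boot all_order all_algebra.
From mathcomp Require Import all_classical all_reals all_analysis.
From mathcomp Require Import ring lra.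

(** The principal eigenvalue of a box is explicit:
    [mu1plus = (pi / diameter)^2], so among boxes of given volume it is largest
    when the diagonal is shortest, i.e. for the cube, by AM-GM.

    - Lower bound: with [k = pi / diameter], the function [cos (k |x|)] is a
      positive supersolution on the circumscribed ball. In midpoint form this is
      [cos |x + y| + cos |x - y| <= 2 cos |x| cos |y|], whose left-hand side, for
      fixed [|x|] and [|y|], is largest when [x] and [y] are collinear.
    - Upper bound: along the diagonal a supersolution is a one-dimensional
      supersolution. It is compared with [cos (k tau)], [tau] being a linear
      coordinate on the diagonal, multiplied by cosines that are constant along the
      diagonal and vanish on the boundary of a thin neighbourhood of it. *)

Set Implicit Arguments.
Unset Strict Implicit.
Unset Printing Implicit Defensive.

Import Order.TTheory GRing.Theory Num.Theory.
Import numFieldNormedType.Exports.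

Local Open Scope classical_set_scope.
Local Open Scope ring_scope.

Lemma cvg_sum_real {R : realType} (T I : Type) (F : set_system T) (r : seq I)
    (f : I -> T -> R) (l : I -> R) : Filter F ->
  (forall i, f i x @[x --> F] --> l i) ->
  \sum_(i <- r) f i x @[x --> F] --> \sum_(i <- r) l i.
Proof. by move=> FF fl; apply: cvg_big => //; exact: add_continuous. Qed.

(** * Largest eigenvalue of a symmetric matrix *)

Section rayleigh.
Context {R : realType} {N : nat}.
Implicit Types (H : 'M[R]_N) (u v w : 'rV[R]_N).

Definition bform H v w : R := (v *m H *m w^T) 0 0.
Definition dot v w : R := (v *m w^T) 0 0.

Lemma bformDl H u v w : bform H (u + v) w = bform H u w + bform H v w.
Proof. by rewrite /bform !mulmxDl mxE. Qed.

Lemma bformDr H u v w : bform H u (v + w) = bform H u v + bform H u w.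
Proof. by rewrite /bform linearD mulmxDr mxE. Qed.

Lemma bformZl H a v w : bform H (a *: v) w = a * bform H v w.
Proof. by rewrite /bform -!scalemxAl mxE. Qed.

Lemma bformZr H a v w : bform H v (a *: w) = a * bform H v w.
Proof. by rewrite /bform linearZ -!scalemxAr mxE. Qed.

Lemma bformC H v w : H^T = H -> bform H v w = bform H w v.
Proof.
move=> HT; rewrite /bform.
have -> : w *m H *m v^T = (v *m H *m w^T)^T by rewrite !trmx_mul trmxK HT mulmxA.
by rewrite [RHS]mxE.
Qed.

Lemma dotE v w : dot v w = bform 1%:M v w.
Proof. by rewrite /dot /bform mulmx1. Qed.

Lemma bform_sum H v w : bform H v w = \sum_i \sum_j v 0 i * H i j * w 0 j.
Proof.
rewrite /bform mxE exchange_big; apply: eq_bigr => j _.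
by rewrite mxE mulr_suml; apply: eq_bigr => i _; rewrite mxE.
Qed.

Lemma dot_sum v w : dot v w = \sum_i v 0 i * w 0 i.
Proof. by rewrite /dot mxE; apply: eq_bigr => i _; rewrite mxE. Qed.

Lemma dotvv_ge0 v : 0 <= dot v v.
Proof. by rewrite dot_sum; apply: sumr_ge0 => i _; rewrite -expr2 sqr_ge0. Qed.

Lemma dotvv_eq0 v : (dot v v == 0) = (v == 0).
Proof.
apply/idP/eqP => [|->]; last by rewrite /dot mul0mx mxE.
rewrite dot_sum psumr_eq0 => [/allP v0|i _]; last by rewrite -expr2 sqr_ge0.
apply/rowP => i; rewrite mxE; apply/eqP; rewrite -sqrf_eq0 expr2.
by apply: v0; rewrite mem_index_enum.
Qed.

Lemma bform_continuous H : continuous (fun v => bform H v v).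
Proof.
move=> v; rewrite (_ : (fun v => _) = fun w => \sum_i \sum_j w 0 i * H i j * w 0 j).
  apply: (@cvg_sum_real _ _ _ (nbhs v)) => i; apply: (@cvg_sum_real _ _ _ (nbhs v)) => j.
  apply: cvgM; last exact: coord_continuous.
  by apply: cvgM; [exact: coord_continuous|exact: cvg_cst].
by apply/funext => w; exact: bform_sum.
Qed.

Lemma dot_continuous : continuous (fun v : 'rV[R]_N => dot v v).
Proof.
have -> : (fun v : 'rV[R]_N => dot v v) = fun v => bform 1%:M v v.
  by apply/funext => v; exact: dotE.
exact: bform_continuous.
Qed.

(** The ambient norm is the sup norm, so boundedness comes from each squared coordinate being at
    most [dot v v]. *)
Lemma compact_unit_sphere : compact [set v : 'rV[R]_N | dot v v = 1].
Proof.
apply: bounded_closed_compact.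
  exists 1; split; first exact: num_real.
  move=> M M1 v /= v1; apply: le_trans (ltW M1).
  rewrite [leLHS]/Num.Def.normr /= mx_normrE; apply/bigmax_leP; split => // -[k i] _ /=.
  rewrite ord1 -(@expr_le1 _ 2) ?normr_ge0// real_normK ?num_real//.
  rewrite -v1 dot_sum (bigD1 i)//= -expr2 lerDl.
  by apply: sumr_ge0 => j _; rewrite -expr2 sqr_ge0.
apply: (@closed_comp _ _ (fun v : 'rV[R]_N => dot v v) [set x | x = 1]).
  by move=> v _; exact: dot_continuous.
exact: closed_eq.
Qed.

(** The quadratic form attains its maximum on the compact unit sphere. Homogeneity extends the bound
    to all [w], and the vanishing first variation makes the maximizer an eigenvector. *)
Lemma rayleigh_max H : (0 < N)%N -> H^T = H ->
  exists2 a, eigenvalue H a & forall w, bform H w w <= a * dot w w.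
Proof.
move=> N0 HT.
have S0 : [set v : 'rV[R]_N | dot v v = 1] !=set0.
  exists (delta_mx 0 (Ordinal N0)); rewrite /= dot_sum (bigD1 (Ordinal N0))//=.
  rewrite mxE !eqxx mulr1 big1 ?addr0// => i /negbTE i0.
  by rewrite mxE i0 andbF mul0r.
have [u] := EVT_max_rV S0 compact_unit_sphere
  (continuous_subspaceT (@bform_continuous H)).
rewrite inE /= => u1 umax.
pose a := bform H u u.
have ray w : bform H w w <= a * dot w w.
  have [->|w0] := eqVneq w 0.
    by rewrite !dotE -(scale0r 0) !bformZl !mul0r mulr0.
  have d0 : 0 < dot w w by rewrite lt_neqAle dotvv_ge0 eq_sym dotvv_eq0 w0.
  pose s := Num.sqrt (dot w w).
  have s0 : s != 0 by rewrite gt_eqF// sqrtr_gt0.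
  have s2 : s * s = dot w w by rewrite -expr2 sqr_sqrtr// ltW.
  have := umax (s^-1 *: w).
  rewrite inE /= dotE bformZl bformZr -dotE -s2 mulrA -[s^-1 * s^-1]invfM.
  rewrite mulVf ?mulf_neq0// => /(_ erefl).
  rewrite bformZl bformZr mulrA -invfM s2 ler_pdivrMl//.
  by rewrite mulrC.
exists a => //; apply/eigenvalueP; exists u; last first.
  by rewrite -dotvv_eq0 u1 oner_eq0.
(* Expanding the bound at [u + t *: w] leaves [2 t b <= t^2 g] for every [t], which forces
   [b = 0]. *)
have ortho w : bform H u w = a * dot u w.
  set g := a * dot w w - bform H w w.
  set b := bform H u w - a * dot u w.
  have g0 : 0 <= g by rewrite subr_ge0.
  have key t : 2 * t * b <= t ^+ 2 * g.
    have := ray (u + t *: w).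
    rewrite dotE !(bformDl, bformDr, bformZl, bformZr) -!dotE u1.
    rewrite (bformC w u HT) [dot w u]dotE (bformC w u (trmx1 _ _)) -dotE -/a.
    rewrite /b /g; lra.
  apply/eqP; rewrite -subr_eq0 -/b -sqrf_eq0 eq_le sqr_ge0 andbT.
  (* The choice [t = b / (g + 1)], whose denominator cannot vanish, turns [key] into
     [b^2 (g + 2) <= 0]. *)
  have := key (b / (g + 1)).
  have g1 : 0 < g + 1 by rewrite ltr_wpDl.
  have -> : 2 * (b / (g + 1)) * b = b ^+ 2 * (2 * (g + 1)) / (g + 1) ^+ 2.
    by field; rewrite gt_eqF.
  have -> : (b / (g + 1)) ^+ 2 * g = b ^+ 2 * g / (g + 1) ^+ 2.
    by field; rewrite gt_eqF.
  rewrite ler_pM2r ?invr_gt0 ?exprn_gt0// -subr_ge0 -mulrBr => h.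
  have gg : 0 < g + 2 by rewrite ltr_wpDl.
  rewrite -(ler_pM2r gg) mul0r; lra.
apply/rowP => j; have := ortho (delta_mx 0 j).
rewrite /bform /dot !mxE (bigD1 j)//= big1 ?addr0; last first.
  by move=> k /negbTE kj; rewrite !mxE kj andbF mulr0.
rewrite (bigD1 j)//= big1 ?addr0; last first.
  by move=> k /negbTE kj; rewrite !mxE kj andbF mulr0.
by rewrite !mxE !eqxx !mulr1.
Qed.

Lemma eigenvalue_bform H a : eigenvalue H a ->
  exists2 v, 0 < dot v v & bform H v v = a * dot v v.
Proof.
move=> /eigenvalueP[v vH v0]; exists v.
  by rewrite lt_neqAle dotvv_ge0 eq_sym dotvv_eq0 v0.
by rewrite /bform vH -scalemxAl mxE.
Qed.

(** The supremum of an empty set would be a default value, so an eigenvalue is exhibited first.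
    Every eigenvalue is a Rayleigh quotient, hence at most [b]. *)
Lemma P1plus_le H b : (0 < N)%N -> H^T = H ->
  (forall w, bform H w w <= b * dot w w) -> P1plus H <= b.
Proof.
move=> N0 HT Hb; have [a0 a0H _] := rayleigh_max N0 HT.
apply: ge_sup; first by exists a0.
move=> a /= /eigenvalue_bform[v v0 va].
by rewrite -(ler_pM2r v0) -va Hb.
Qed.

(** The maximal Rayleigh quotient [a] is an eigenvalue and bounds all the others, so the supremum is
    a genuine one and lies above [a]. *)
Lemma P1plus_ge H w : (0 < N)%N -> H^T = H ->
  bform H w w <= P1plus H * dot w w.
Proof.
move=> N0 HT; have [a aH ray] := rayleigh_max N0 HT.
apply: le_trans (ray w) _; apply: ler_wpM2r; first exact: dotvv_ge0.
apply: ub_le_sup => //; exists a => b /= /eigenvalue_bform[v v0 va].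
by rewrite -(ler_pM2r v0) -va.
Qed.

End rayleigh.

(** * Directional derivatives of C^2 functions *)

Section increments.
Context {R : realType} {V : normedModType R}.
Implicit Types (f g : V -> R) (x y v w : V).

(** A division-free form of differentiability, valid also at [h = 0], so that error terms can be
    added directly. *)
Lemma is_deriveP f x v (d : R) : is_derive x v f d <->
  forall e, 0 < e -> exists2 del, 0 < del & forall h, `|h| < del ->
    `|f (x + h *: v) - f x - h * d| <= e * `|h|.
Proof.
have quot h e : h != 0 ->
    (`|d - h^-1 *: (f (h *: v + x) - f x)| <= e) =
    (`|f (x + h *: v) - f x - h * d| <= e * `|h|).
  move=> h0; rewrite [x + _]addrC -[RHS](ler_pM2l (_ : 0 < `|h|^-1)); last first.
    by rewrite invr_gt0 normr_gt0.
  rewrite mulrCA mulVf ?normr_eq0// mulr1 -normfV -normrM mulrBr mulKf//.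
  by rewrite distrC.
split=> [[df dE] e e0|H].
  move: df; rewrite /derivable => /cvgrPdist_le /(_ _ e0).
  rewrite near_withinE => /nbhs_norm0P[del /= del0 H]; exists del => // h hdel.
  have [->|h0] := eqVneq h 0.
    by rewrite scale0r addr0 subrr mul0r subr0 normr0 mulr0.
  by move: (H h hdel h0); rewrite -/(derive f x v) dE /= quot.
have cv : (fun h => h^-1 *: ((f \o shift x) (h *: v) - f x)) @ 0^' --> d.
  apply/cvgrPdist_le => e e0; rewrite near_withinE; apply: (iffRL (@nbhs_norm0P R R^o _)).
  have [del del0 Hd] := H e e0; exists del => // h.
  rewrite /= => hdel h0.
  by rewrite quot//; exact: Hd.
by split; [apply/cvg_ex; exists d|exact/cvg_lim].
Qed.

End increments.

Section strict_derivative.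
Context {R : realType} {V : normedModType R}.
Implicit Types (f g : V -> R) (x y v w : V).

Lemma is_derive_lineP f x v t (d : R) :
  is_derive (x + t *: v) v f d <-> is_derive t 1 (fun s => f (x + s *: v)) d.
Proof.
rewrite is_deriveP.
have -> : is_derive t 1 (fun s => f (x + s *: v)) d <->
  forall e, 0 < e -> exists2 del, 0 < del & forall h, `|h| < del ->
    `|f (x + (t + h *: 1) *: v) - f (x + t *: v) - h * d| <= e * `|h|.
  exact: (@is_deriveP R R).
by split => H e /H[del del0 Hd]; exists del => // h /Hd;
  rewrite [h *: 1]mulr1 scalerDl addrA.
Qed.

Lemma mvt_line f x v (h : R) :
  (forall s : R, `|s| <= `|h| -> derivable f (x + s *: v) v) ->
  exists2 s : R, `|s| <= `|h| & f (x + h *: v) - f x = h * 'D_v f (x + s *: v).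
Proof.
move=> df; pose g (s : R) := f (x + s *: v).
have dg (s : R) : `|s| <= `|h| -> is_derive s 1 g ('D_v f (x + s *: v)).
  by move=> /df /derivableP dfs; apply/is_derive_lineP.
have cg a b : `|a| <= `|h| -> `|b| <= `|h| -> {within `[a, b], continuous g}.
  move=> ah bh; apply: derivable_within_continuous => s; rewrite in_itv /= => sab.
  suff /dg[] : `|s| <= `|h| by [].
  by move: ah bh; rewrite !ler_norml => /andP[? ?] /andP[? ?]; apply/andP; lra.
have f0 : f x = g 0 by rewrite /g scale0r addr0.
have h00 : `|0 : R| <= `|h| by rewrite normr0.
have [h0|h0] := leP 0 h.
  have [s||s] := @MVT_segment R g (fun s => 'D_v f (x + s *: v)) 0 h h0.
  - rewrite in_itv /= => /andP[s0 sh]; apply: dg.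
    by rewrite (ger0_norm (ltW s0)) (ger0_norm h0) ltW.
  - exact: cg.
  - rewrite in_itv /= => /andP[s0 sh] E; exists s; first by rewrite !ger0_norm.
    by rewrite f0 -/(g h) E subr0 mulrC.
have [s||s] := @MVT_segment R g (fun s => 'D_v f (x + s *: v)) h 0 (ltW h0).
- rewrite in_itv /= => /andP[s0 sh]; apply: dg.
  by rewrite !ltr0_norm// lerN2 ltW.
- exact: cg.
- rewrite in_itv /= => /andP[s0 sh] E; exists s.
    by rewrite !ler0_norm ?lerN2// ltW.
  by rewrite f0 -/(g h) -opprB E sub0r mulrN opprK mulrC.
Qed.

(** Uniformity in the base point [y] makes this notion additive in the direction [v], which plain
    directional differentiability is not. It thus passes from partial derivatives to all
    directions. *)
Definition strict_derive f x v (d : R) := forall e, 0 < e ->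
  exists2 del, 0 < del & forall y (h : R), `|y - x| < del -> `|h| < del ->
    `|f (y + h *: v) - f y - h * d| <= e * `|h|.

Lemma strict_derive_is_derive f x v d :
  strict_derive f x v d -> is_derive x v f d.
Proof.
move=> H; apply/is_deriveP => e /H[del del0 Hd]; exists del => // h hd.
by apply: Hd => //; rewrite subrr normr0.
Qed.

Lemma strict_derive0 f x : strict_derive f x 0 0.
Proof.
move=> e e0; exists 1 => // y h _ _.
by rewrite scaler0 addr0 subrr mulr0 subrr normr0 mulr_ge0// ltW.
Qed.

Lemma shift_near x y (h : R) v (del : R) : 0 < del ->
  `|y - x| < del / (1 + `|v|) -> `|h| < del / (1 + `|v|) ->
  `|y + h *: v - x| < del.
Proof.
move=> del0 yx hd; rewrite addrAC; apply: le_lt_trans (ler_normD _ _) _.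
have v1 : 0 < 1 + `|v| by rewrite ltr_pwDl.
have -> : del = del / (1 + `|v|) + del / (1 + `|v|) * `|v|.
  by field; rewrite gt_eqF.
by rewrite normrZ ltr_leD// ler_wpM2r// ltW.
Qed.

(** The increment is split into a step along [v] and then one along [w]; the second starts at the
    moved point [y + h *: v], which uniformity in the base point permits. *)
Lemma strict_deriveD f x v w a b : strict_derive f x v a ->
  strict_derive f x w b -> strict_derive f x (v + w) (a + b).
Proof.
move=> Hv Hw e e0; have e20 : 0 < e / 2 by rewrite divr_gt0.
have [dv dv0 {}Hv] := Hv _ e20; have [dw dw0 {}Hw] := Hw _ e20.
have v1 : 0 < 1 + `|v| by rewrite ltr_pwDl.
have dwv : dw / (1 + `|v|) <= dw.
  by rewrite ler_pdivrMr// ler_peMr ?lerDl// ltW.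
exists (Num.min dv (dw / (1 + `|v|))); first by rewrite lt_min dv0 divr_gt0.
move=> y h; rewrite !lt_min => /andP[yv yw] /andP[hv hw].
have -> : f (y + h *: (v + w)) - f y - h * (a + b) =
    (f (y + h *: v) - f y - h * a) +
    (f (y + h *: v + h *: w) - f (y + h *: v) - h * b).
  by rewrite scalerDr addrA; ring.
apply: le_trans (ler_normD _ _) _; rewrite [e]splitr mulrDl lerD//.
  exact: Hv.
by apply: Hw; [exact: shift_near|exact: lt_le_trans hw _].
Qed.

Lemma strict_deriveZ f x v c a :
  strict_derive f x v a -> strict_derive f x (c *: v) (c * a).
Proof.
move=> H e e0; have c1 : 0 < 1 + `|c| by rewrite ltr_pwDl.
have [|del del0 {}H] := H (e / (1 + `|c|)); first by rewrite divr_gt0.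
have dc : del / (1 + `|c|) <= del.
  by rewrite ler_pdivrMr// ler_peMr ?lerDl// ltW.
exists (del / (1 + `|c|)); first by rewrite divr_gt0.
move=> y h yd hd; rewrite scalerA mulrA.
apply: le_trans (H _ _ _ _) _; first exact: lt_le_trans yd _.
  rewrite normrM; have [->|c0] := eqVneq c 0; first by rewrite normr0 mulr0.
  apply: (@le_lt_trans _ _ (`|h| * (1 + `|c|))); last by rewrite -ltr_pdivlMr.
  by rewrite ler_wpM2l// lerDr.
rewrite normrM [X in X <= _](_ : _ = e * `|h| * (`|c| / (1 + `|c|))); last by ring.
by rewrite ler_piMr ?mulr_ge0// ?ltW// ltr_pdivrMr// mul1r ltrDr.
Qed.

Lemma strict_derive_sum f x (I : Type) (r : seq I) (v : I -> V) (a : I -> R) :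
  (forall i, strict_derive f x (v i) (a i)) ->
  strict_derive f x (\sum_(i <- r) v i) (\sum_(i <- r) a i).
Proof.
move=> H; elim: r => [|i r IH]; first by rewrite !big_nil; exact: strict_derive0.
by rewrite !big_cons; exact: strict_deriveD.
Qed.

(** The mean value theorem turns the increment into [h] times a derivative at a nearby point, which
    continuity compares with the one at [x]. *)
Lemma strict_derive_continuous f x v :
  (\forall y \near x, derivable f y v) -> {for x, continuous ('D_v f)} ->
  strict_derive f x v ('D_v f x).
Proof.
move=> df /cvgrPdist_le cD e e0.
have : \forall y \near x, derivable f y v /\ `|'D_v f x - 'D_v f y| <= e.
  by apply: filterI => //; exact: cD.
move=> /nbhs_normP[del /= del0 H].
have v1 : 0 < 1 + `|v| by rewrite ltr_pwDl.
exists (del / (1 + `|v|)) => [|y h yd hd]; first by rewrite divr_gt0.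
have near (s : R) : `|s| <= `|h| -> `|x - (y + s *: v)| < del.
  by move=> sh; rewrite distrC shift_near// (le_lt_trans sh).
have [|s sh ->] := @mvt_line f y v h; first by move=> s /near /H[].
rewrite -mulrBr normrM mulrC ler_wpM2r// distrC.
by have [] := H _ (near s sh).
Qed.

End strict_derivative.

Lemma is_derive_translate {R : realType} {V : normedModType R} (f : V -> R)
    (x c v : V) (d : R) :
  is_derive (x + c) v f d -> is_derive x v (fun y => f (y + c)) d.
Proof.
move=> /is_deriveP H; apply/is_deriveP => e /H[del del0 Hd].
by exists del => // h /Hd; rewrite (addrAC x c).
Qed.

(** * Second derivatives along lines and symmetry of the Hessian *)

Section second_order.
Context {R : realType} {N : nat}.
Variables (Omega : set 'rV[R]_N) (psi : 'rV[R]_N -> R).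
Hypotheses (oO : open Omega) (C2 : C2_on Omega psi).
Implicit Types (x v : 'rV[R]_N).

Lemma C2_near_derivable x i : Omega x ->
  \forall y \near x, derivable psi y (basis_vec i).
Proof.
move=> Ox; near=> y; have Oy : Omega y by near: y; exact: open_nbhs_nbhs (conj oO Ox).
by have [_ /(_ i)[]] := C2 Oy.
Unshelve. all: by end_near. Qed.

Lemma C2_near_derivable2 x i j : Omega x ->
  \forall y \near x, derivable (partial j psi) y (basis_vec i).
Proof.
move=> Ox; near=> y; have Oy : Omega y by near: y; exact: open_nbhs_nbhs (conj oO Ox).
by have [_ /(_ j)[_ _ /(_ i)[]]] := C2 Oy.
Unshelve. all: by end_near. Qed.

Lemma C2_strict x v : Omega x ->
  strict_derive psi x v (\sum_j v 0 j * partial j psi x).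
Proof.
move=> Ox; rewrite [v in strict_derive _ _ v](row_sum_delta v).
apply: strict_derive_sum => j; apply: strict_deriveZ.
apply: strict_derive_continuous; first exact: C2_near_derivable.
by have [_ /(_ j)[]] := C2 Ox.
Qed.

Lemma C2_strict2 x v j : Omega x ->
  strict_derive (partial j psi) x v (\sum_i v 0 i * partial i (partial j psi) x).
Proof.
move=> Ox; rewrite [v in strict_derive _ _ v](row_sum_delta v).
apply: strict_derive_sum => i; apply: strict_deriveZ.
apply: strict_derive_continuous; first exact: C2_near_derivable2.
by have [_ /(_ j)[_ _ /(_ i)[]]] := C2 Ox.
Qed.

(** By [C2_strict] the differentiated sum is the derivative of [psi] along [v], so this is the
    second derivative on the line: the link between the Hessian and one-dimensional arguments. *)
Lemma C2_directional2 x v : Omega x ->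
  is_derive x v (fun y => \sum_j v 0 j * partial j psi y)
    (bform (hessian psi x) v v).
Proof.
move=> Ox.
have -> : (fun y => \sum_j v 0 j * partial j psi y) =
    \sum_j (v 0 j \*: partial j psi).
  by apply/funext => y; rewrite fct_sumE.
rewrite bform_sum exchange_big.
apply: is_derive_sum => j.
apply: is_derive_eq.
  by apply: is_deriveZ; apply: strict_derive_is_derive; exact: C2_strict2.
rewrite scaler_sumr; apply: eq_bigr => i _.
by rewrite /hessian mxE /GRing.scale /=; ring.
Qed.

(* Both mixed derivatives are limits of the same second difference quotient. *)
Lemma second_difference x i j e : Omega x -> 0 < e ->
  exists2 del, 0 < del & forall h : R, `|h| < del ->
    `|psi (x + h *: basis_vec i + h *: basis_vec j) - psi (x + h *: basis_vec i)
       - psi (x + h *: basis_vec j) + psi x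
       - h ^+ 2 * partial i (partial j psi) x| <= e * h ^+ 2.
Proof.
move=> Ox e0.
have : strict_derive (partial j psi) x (basis_vec i)
    (partial i (partial j psi) x).
  apply: strict_derive_continuous; first exact: C2_near_derivable2.
  by have [_ /(_ j)[_ _ /(_ i)[]]] := C2 Ox.
move=> /(_ _ e0)[d1 d10 H1].
have /nbhs_normP[d2 /= d20 H2] : nbhs x Omega by exact: open_nbhs_nbhs (conj oO Ox).
set u : 'rV[R]_N := basis_vec i; set w : 'rV[R]_N := basis_vec j.
(* Each division pays for one of two successive shifts, by [h *: u] and then by [s *: w], so that
   both stay in [Omega]. *)
pose d3 := d2 / (1 + `|w|) / (1 + `|u|).
have u1 : 0 < 1 + `|u| by rewrite ltr_pwDl.
have w1 : 0 < 1 + `|w| by rewrite ltr_pwDl.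
exists (Num.min d3 (Num.min d1 (d1 / (1 + `|w|)))).
  by rewrite !lt_min d10 !divr_gt0.
move=> h; rewrite !lt_min => /and3P[h3 h1 h1w].
have d3w : d3 <= d2 / (1 + `|w|).
  by rewrite ler_pdivrMr// ler_peMr ?lerDl// ltW// divr_gt0.
have sw (s : R) : `|s| <= `|h| -> `|x + s *: w - x| < d1.
  move=> sh; apply: shift_near => //; first by rewrite subrr normr0 divr_gt0.
  exact: le_lt_trans h1w.
have Osw (s : R) : `|s| <= `|h| -> Omega (x + s *: w).
  move=> sh; apply: H2; rewrite /ball_ /= distrC; apply: shift_near => //.
    by rewrite subrr normr0 divr_gt0.
  exact: le_lt_trans sh (lt_le_trans h3 _).
have Osuw (s : R) : `|s| <= `|h| -> Omega (x + h *: u + s *: w).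
  move=> sh; apply: H2; rewrite /ball_ /= distrC; apply: shift_near => //.
    by apply: shift_near; rewrite ?subrr ?normr0 ?divr_gt0.
  exact: le_lt_trans sh (lt_le_trans h3 _).
(* The second difference is an increment along [w] of the first difference [q]. The mean value
   theorem along [w] leaves an increment of [partial j psi] along [u], to which the strict
   derivative at [x] applies. *)
pose q y := psi (y + h *: u) - psi y.
have dq (s : R) : `|s| <= `|h| ->
    is_derive (x + s *: w) w q
      (partial j psi (x + s *: w + h *: u) - partial j psi (x + s *: w)).
  move=> sh; apply: is_deriveB; first apply: is_derive_translate.
    apply/derivableP; rewrite addrAC.
    by have [_ /(_ j)[]] := C2 (Osuw _ sh).
  by apply/derivableP; have [_ /(_ j)[]] := C2 (Osw _ sh).
have [|s sh E] := @mvt_line _ _ q x w h; first by move=> s /dq[].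
have -> : psi (x + h *: u + h *: w) - psi (x + h *: u) - psi (x + h *: w) + psi x
    = q (x + h *: w) - q x.
  by rewrite /q [x + h *: w + _]addrAC; ring.
rewrite E; have [_ ->] := dq s sh.
have -> : e * h ^+ 2 = `|h| * (e * `|h|).
  by rewrite [RHS]mulrCA -normrM -expr2 ger0_norm ?sqr_ge0.
rewrite expr2 -mulrA -mulrBr normrM ler_wpM2l// H1//; exact: sw.
Qed.

Lemma hessian_sym x : Omega x -> (hessian psi x)^T = hessian psi x.
Proof.
move=> Ox; apply/matrixP => i j; rewrite !mxE.
apply/eqP; rewrite -subr_eq0 -normr_le0; apply/ler_addgt0Pl => e e0.
rewrite addr0.
have e20 : 0 < e / 2 by rewrite divr_gt0.
have [d1 d10 H1] := second_difference i j Ox e20.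
have [d2 d20 H2] := second_difference j i Ox e20.
pose h := Num.min d1 d2 / 2.
have m0 : 0 < Num.min d1 d2 by rewrite lt_min d10.
have h0 : 0 < h by rewrite divr_gt0.
have hm : `|h| < Num.min d1 d2 by rewrite gtr0_norm// ltr_pdivrMr// ltr_pMr// ltr1n.
move: hm; rewrite lt_min => /andP[/H1 {}H1 /H2].
rewrite (addrAC x (h *: basis_vec j)) => {}H2.
move: H1 H2; have : 0 < h ^+ 2 by rewrite exprn_gt0.
move: (psi _) (psi _) (psi _) (psi _) (partial _ _ _) (partial _ _ _) (h ^+ 2).
move=> a b c d p q H H0 H1 H2; rewrite -(ler_pM2l H0).
rewrite -[X in X * `|_|](gtr0_norm H0) -normrM.
move: H1 H2; rewrite !ler_norml => /andP[? ?] /andP[? ?]; apply/andP; split; lra.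
Qed.

End second_order.

(** * The supersolution on a ball *)

Section trigonometry.
Context {R : realType}.
Implicit Types (a b s u x p q : R).

Lemma mulr_cos_le_sin x : 0 <= x <= pi -> x * cos x <= sin x.
Proof.
move=> /andP[x0 xpi]; pose m (t : R) := t * cos t - sin t.
have dm (t : R) : is_derive t 1 m (- (t * sin t)).
  apply: is_derive_eq; rewrite /GRing.scale /=; ring.
have [|c] := @MVT_segment R m (fun t => - (t * sin t)) 0 x x0.
  by apply: derivable_within_continuous => t _; have [] := dm t.
rewrite in_itv /= => /andP[c0 cx].
rewrite /m mul0r sin0 !subr0 => E; rewrite -subr_le0 E.
rewrite mulNr oppr_le0 !mulr_ge0// sin_ge0_pi// c0/=.
exact: le_trans xpi.
Qed.

(* The derivative of [t => q sin t - t sin q] is at most [q cos q - sin q <= 0]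
   on [q, pi]. *)
Lemma sinc_nincr p q : 0 < q -> q <= p -> p <= pi -> q * sin p <= p * sin q.
Proof.
move=> q0 qp ppi; pose f (t : R) := q * sin t - t * sin q.
have df (t : R) : is_derive t 1 f (q * cos t - sin q).
  apply: is_derive_eq; rewrite /GRing.scale /=; ring.
have [|c] := @MVT_segment R f (fun t => q * cos t - sin q) q p qp.
  by apply: derivable_within_continuous => t _; have [] := df t.
rewrite in_itv /= => /andP[qc cp].
rewrite /f subrr subr0 => E; rewrite -subr_le0 E mulr_le0_ge0 ?subr_ge0//.
have qpi : q <= pi by exact: le_trans ppi.
rewrite subr_le0; apply: le_trans (@mulr_cos_le_sin q _); last by rewrite ltW.
apply: ler_wpM2l; first exact: ltW.
rewrite leNgt ltr_cos ?in_itv/= ?(ltW q0)//; first by rewrite -leNgt.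
by rewrite (le_trans (ltW q0) qc) (le_trans cp).
Qed.

(** Here [a] and [b] stand for [|x|] and [|y|], and [u] for twice their inner product. The left side
    is nondecreasing in [|u|] because [sin t / t] decreases on [(0, pi]]; at [|u| = 2 a b] the roots
    are [a + b] and [|a - b|], and the addition formulas give equality. *)
Lemma cos_sqrtD_le a b u : 0 <= a -> 0 <= b -> a + b <= pi ->
  `|u| <= 2 * a * b ->
  cos (Num.sqrt (a ^+ 2 + b ^+ 2 + u)) + cos (Num.sqrt (a ^+ 2 + b ^+ 2 - u))
    <= 2 * (cos a * cos b).
Proof.
move=> a0 b0 abpi uab.
pose s := a ^+ 2 + b ^+ 2; pose U := 2 * a * b.
pose h (w : R) := cos (Num.sqrt (s + w)) + cos (Num.sqrt (s - w)).
suff hU w : 0 <= w -> w <= U -> h w <= 2 * (cos a * cos b).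
  rewrite -/s; move: uab; rewrite ler_norml => /andP[u1 u2].
  have [u0|u0] := leP 0 u; first exact: hU.
  have := hU (- u); rewrite /h opprK addrC; apply; first by rewrite oppr_ge0 ltW.
  by rewrite lerNl.
move=> w0 wU.
have sU : U <= s by rewrite /s /U -subr_ge0 (_ : _ - _ = (a - b) ^+ 2) ?sqr_ge0//; ring.
have -> : 2 * (cos a * cos b) = h U.
  rewrite /h (_ : s + U = (a + b) ^+ 2); last by rewrite /s /U; ring.
  rewrite (_ : s - U = (a - b) ^+ 2); last by rewrite /s /U; ring.
  by rewrite !sqrtr_sqr !cos_norm cosD cosB; ring.
have ds (e t : R) : 0 < s + e * t -> is_derive t 1 (fun t => Num.sqrt (s + e * t))
   ((2 * Num.sqrt (s + e * t))^-1 * e).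
  move=> st; apply: (@is_derive1_comp _ Num.sqrt (fun t => s + e * t)).
    exact: is_derive1_sqrt.
  by apply: is_derive_eq; rewrite /GRing.scale /=; ring.
pose dh (t : R) := - sin (Num.sqrt (s + 1 * t)) * ((2 * Num.sqrt (s + 1 * t))^-1 * 1)
  + - sin (Num.sqrt (s + -1 * t)) * ((2 * Num.sqrt (s + -1 * t))^-1 * -1).
have hE : h = (cos \o (fun t => Num.sqrt (s + 1 * t))) \+
              (cos \o (fun t => Num.sqrt (s + -1 * t))).
  by apply/funext => t; rewrite /h /= mul1r mulN1r.
have pos (t : R) : 0 <= t -> t < U -> 0 < s + -1 * t /\ 0 < s + 1 * t.
  by move=> t0 tU; split; lra.
have dh' (t : R) : 0 <= t -> t < U -> is_derive t 1 h (dh t).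
  move=> t0 /(pos _ t0)[sm sp]; rewrite hE.
  by apply: is_deriveD; apply: is_derive1_comp; apply: ds.
have sqc (e : R) : continuous (fun t : R => Num.sqrt (s + e * t)).
  move=> t; apply: (@continuous_comp _ _ _ (fun t => s + e * t) Num.sqrt).
    by apply: cvgD; [exact: cvg_cst|apply: cvgM; [exact: cvg_cst|exact: cvg_id]].
  exact: sqrt_continuous.
have [wU'|] := ltP w U; last first.
  by move=> Uw; rewrite (le_anti (_ : U <= w <= U)) ?Uw ?wU.
(* At [U] one radicand is [(a - b)^2], possibly zero, where the square root is not differentiable;
   the mean value theorem needs only continuity at that endpoint. *)
have [t||c] := @MVT R h dh w U wU'.
- by rewrite in_itv /= => /andP[wt tU]; apply: dh' => //; exact: le_trans w0 (ltW wt).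
- apply: continuous_subspaceT => t; rewrite hE.
  by apply: cvgD; apply: continuous_comp; by [exact: sqc|exact: continuous_cos].
rewrite in_itv /= => /andP[wc cU] E; rewrite -subr_ge0 E.
have c0 : 0 <= c by exact: le_trans (ltW wc).
rewrite mulr_ge0 ?subr_ge0// /dh.
have [sm sp] := pos _ c0 cU.
set P := Num.sqrt (s + 1 * c); set Q := Num.sqrt (s + -1 * c).
have Q0 : 0 < Q by rewrite sqrtr_gt0.
have P0 : 0 < P by rewrite sqrtr_gt0.
have QP : Q <= P by rewrite ler_sqrt//; lra.
have Ppi : P <= pi.
  apply: le_trans abpi; rewrite -[a + b]ger0_norm ?addr_ge0// -sqrtr_sqr.
  rewrite ler_sqrt ?sqr_ge0//.
  rewrite (_ : (a + b) ^+ 2 = s + U) ?mul1r ?lerD2l ?ltW//; rewrite /s /U; ring.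
have := sinc_nincr Q0 QP Ppi; rewrite -subr_ge0 => sQP.
rewrite [leRHS](_ : _ = (P * sin Q - Q * sin P) / (2 * P * Q)).
  by rewrite divr_ge0// !mulr_ge0// ltW.
by field; rewrite !gt_eqF.
Qed.

End trigonometry.

(** If [D] were positive, [F'] would be positive just to the right of 0, and the mean value theorem
    would push [F] above [F 0] there. *)
Lemma second_derive_le0 {R : realType} (F F' : R -> R) (D : R) :
  (\forall t \near (0 : R), is_derive (t : R) 1 F (F' t)) -> F' 0 = 0 ->
  is_derive (0 : R) 1 F' D -> (\forall t \near (0 : R), F t <= F 0) -> D <= 0.
Proof.
move=> dF F'0 /is_deriveP dF' Fmax; rewrite leNgt; apply/negP => D0.
have [|d d0 Hd] := dF' (D / 2); first by rewrite divr_gt0.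
have : \forall t \near (0 : R), is_derive (t : R) 1 F (F' t) /\ F t <= F 0.
  by apply: filterI.
move=> /nbhs_norm0P[d' /= d'0 H].
pose t := Num.min d d' / 2.
have m0 : 0 < Num.min d d' by rewrite lt_min d0.
have t0 : 0 < t by rewrite divr_gt0.
have tm : t < Num.min d d' by rewrite ltr_pdivrMr// ltr_pMr// ltr1n.
move: tm; rewrite lt_min => /andP[td td'].
have near0 (s : R) : 0 <= s -> s <= t -> is_derive s 1 F (F' s) /\ F s <= F 0.
  by move=> s0 st; apply: H; rewrite /= ger0_norm// (le_lt_trans st).
have [s||c] := @MVT R F F' 0 t t0.
- by rewrite in_itv /= => /andP[s0 st]; have [] := near0 s (ltW s0) (ltW st).
- apply: derivable_within_continuous => s; rewrite in_itv /= => /andP[s0 st].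
  by have [[]] := near0 s s0 st.
rewrite in_itv /= => /andP[c0 ct] E.
have : F t - F 0 <= 0 by rewrite subr_le0; have [] := near0 t (ltW t0) (lexx t).
rewrite E subr0 leNgt pmulr_lgt0//; apply/negP; rewrite negbK.
have := Hd c; rewrite gtr0_norm// (lt_trans ct)// => /(_ isT).
rewrite [c *: 1]mulr1 add0r F'0 subr0 ler_norml => /andP[h _].
by apply: lt_le_trans (_ : c * D / 2 <= _); [rewrite divr_gt0// mulr_gt0|lra].
Qed.

Section ball_supersolution.
Context {R : realType} {N : nat}.
Implicit Types (x v : 'rV[R]_N).

Lemma dotC x v : dot x v = dot v x.
Proof. by rewrite !dotE bformC// trmx1. Qed.

Lemma dotD_line x v t : dot (x + t *: v) (x + t *: v) =
  dot x x + t ^+ 2 * dot v v + 2 * t * dot x v.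
Proof.
rewrite dotE !(bformDl, bformDr, bformZl, bformZr) -!dotE (dotC v x); ring.
Qed.

Lemma dot_cauchy_schwarz x v : dot x v ^+ 2 <= dot x x * dot v v.
Proof.
have [->|x0] := eqVneq x 0.
  by rewrite /dot !mul0mx mxE mul0r expr0n.
have a0 : 0 < dot x x by rewrite lt_neqAle dotvv_ge0 eq_sym dotvv_eq0 x0.
have := dotvv_ge0 (v + (- (dot x v / dot x x)) *: x).
rewrite dotD_line (dotC v x) -(ler_pM2l a0) mulr0.
set a := dot x x; set b := dot x v; set c := dot v v => H.
rewrite -subr_ge0; apply: le_trans H _; rewrite le_eqVlt; apply/orP; left.
by apply/eqP; field; rewrite gt_eqF.
Qed.

Definition radial_cos (k : R) x := cos (k * Num.sqrt (dot x x)).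

Lemma radial_cos_continuous k : continuous (radial_cos k).
Proof.
move=> x.
have c1 : {for x, continuous (fun x : 'rV[R]_N => Num.sqrt (dot x x))}.
  apply: (@continuous_comp _ _ _ (fun x : 'rV[R]_N => dot x x) Num.sqrt).
    exact: (@dot_continuous R N).
  exact: sqrt_continuous.
have c2 : {for x, continuous (fun x : 'rV[R]_N => k * Num.sqrt (dot x x))}.
  by apply: (@continuousM _ _ (fun=> k)); [exact: cst_continuous|exact: c1].
apply: (@continuous_comp _ _ _ _ cos _ c2).
exact: continuous_cos.
Qed.

(** This is [cos_sqrtD_le] with its bound on [u] supplied by Cauchy-Schwarz. The midpoint form
    avoids differentiating [|x|], which is singular at the origin. *)
Lemma radial_cos_midpoint k x v t : 0 <= k ->
  k * Num.sqrt (dot x x) + `|t| * (k * Num.sqrt (dot v v)) <= pi ->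
  radial_cos k (x + t *: v) + radial_cos k (x + (- t) *: v) <=
  2 * (radial_cos k x * cos (t * (k * Num.sqrt (dot v v)))).
Proof.
move=> k0 kpi.
have kE y : k * Num.sqrt (dot y y) = Num.sqrt (k ^+ 2 * dot y y).
  by rewrite sqrtrM ?sqr_ge0// sqrtr_sqr ger0_norm.
have -> : cos (t * (k * Num.sqrt (dot v v))) =
    cos (`|t| * (k * Num.sqrt (dot v v))).
  by rewrite -cos_norm normrM [X in _ * X]ger0_norm// mulr_ge0.
have aE : (k * Num.sqrt (dot x x)) ^+ 2 = k ^+ 2 * dot x x.
  by rewrite exprMn sqr_sqrtr ?dotvv_ge0.
have bE : (`|t| * (k * Num.sqrt (dot v v))) ^+ 2 = t ^+ 2 * (k ^+ 2 * dot v v).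
  by rewrite !exprMn sqr_sqrtr ?dotvv_ge0// real_normK ?num_real.
have a0 : 0 <= k * Num.sqrt (dot x x) by rewrite mulr_ge0.
have b0 : 0 <= `|t| * (k * Num.sqrt (dot v v)) by rewrite !mulr_ge0.
pose u := k ^+ 2 * (2 * t * dot x v).
have uab : `|u| <= 2 * (k * Num.sqrt (dot x x)) * (`|t| * (k * Num.sqrt (dot v v))).
  have -> : 2 * (k * Num.sqrt (dot x x)) * (`|t| * (k * Num.sqrt (dot v v))) =
      k ^+ 2 * (2 * `|t| * (Num.sqrt (dot x x) * Num.sqrt (dot v v))) by ring.
  rewrite /u normrM [`|k ^+ 2|]ger0_norm ?sqr_ge0// ler_wpM2l ?sqr_ge0//.
  rewrite !normrM normr_nat ler_wpM2l ?mulr_ge0//.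
  by rewrite -sqrtrM ?dotvv_ge0// -sqrtr_sqr ler_wsqrtr// dot_cauchy_schwarz.
have := cos_sqrtD_le a0 b0 kpi uab.
rewrite aE bE /radial_cos !kE !dotD_line.
have -> : k ^+ 2 * dot x x + t ^+ 2 * (k ^+ 2 * dot v v) + u =
  k ^+ 2 * (dot x x + t ^+ 2 * dot v v + 2 * t * dot x v) by rewrite /u; ring.
have -> : k ^+ 2 * dot x x + t ^+ 2 * (k ^+ 2 * dot v v) - u =
  k ^+ 2 * (dot x x + (- t) ^+ 2 * dot v v + 2 * - t * dot x v) by rewrite /u; ring.
by [].
Qed.

(** Adding the touching inequality at [x0 + t *: v] and [x0 - t *: v] and using the midpoint bound
    shows that [F] has a local maximum at 0. Its second derivative there is
    [2 (bform H v v + m l^2)], which bounds the Hessian in every direction. *)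
Lemma ball_admissible (Omega : set 'rV[R]_N) (k : R) : (0 < N)%N -> 0 <= k ->
  open Omega -> (forall x, Omega x -> k * Num.sqrt (dot x x) < pi / 2) ->
  admissible Omega (k ^+ 2).
Proof.
move=> N0 k0 oO Ok.
have pos x : Omega x -> 0 < radial_cos k x.
  move=> /Ok kx; apply: cos_gt0_pihalf; rewrite kx andbT.
  apply: lt_le_trans (_ : 0 <= _); first by rewrite oppr_lt0 divr_gt0 ?pi_gt0.
  by rewrite mulr_ge0.
exists (radial_cos k); split => //.
  move=> x a; rewrite /= lte_fin => ax.
  exists [set y | a < radial_cos k y]; last by move=> y; rewrite lte_fin.
  have cs := @continuous_subspaceT _ _ Omega _ (@radial_cos_continuous k).
  have ax' : nbhs (radial_cos k x) [set y | a < y].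
    by apply: open_nbhs_nbhs; split => //; exact: open_gt.
  exact: (cs x _ ax').
move=> psi x0 C2 Ox0 touch.
rewrite -lerBrDr sub0r; apply: P1plus_le => //; first exact: (hessian_sym oO C2).
move=> v; set m := radial_cos k x0; set H := hessian psi x0.
pose l := k * Num.sqrt (dot v v).
have l0 : 0 <= l by rewrite mulr_ge0.
pose g (t : R) := psi (x0 + t *: v).
pose G (t : R) := \sum_j v 0 j * partial j psi (x0 + t *: v).
pose F (t : R) := g t + g (- t) - 2 * m * cos (l * t).
pose F' (t : R) := G t - G (- t) + 2 * m * l * sin (l * t).
suff : 2 * (bform H v v + m * l ^+ 2) <= 0.
  rewrite pmulr_rle0// /l exprMn sqr_sqrtr ?dotvv_ge0// -lerBrDr sub0r => h.
  by apply: le_trans h _; rewrite le_eqVlt; apply/orP; left; apply/eqP; ring.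
have line (P : set 'rV[R]_N) : nbhs x0 P ->
    \forall t \near (0 : R), P (x0 + t *: v) /\ P (x0 + (- t) *: v).
  move=> /nbhs_normP[d /= d0 Pd]; apply/(@nbhs_norm0P R R^o).
  have v1 : 0 < 1 + `|v| by rewrite ltr_pwDl.
  exists (d / (1 + `|v|)) => [|t /= td]; first by rewrite /= divr_gt0.
  by split; apply: Pd; rewrite /ball_ /= distrC; apply: shift_near;
    rewrite ?subrr ?normr0 ?divr_gt0 ?normrN.
have dg (t : R) : Omega (x0 + t *: v) -> is_derive t 1 g (G t).
  move=> Ot; apply/(@is_derive_lineP _ _ psi x0 v t (G t)).
  exact: (strict_derive_is_derive (C2_strict oO C2 v Ot)).
have dG : is_derive (0 : R) 1 G (bform H v v).
  apply/(is_derive_lineP (fun y => \sum_j v 0 j * partial j psi y)).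
  by rewrite scale0r addr0; exact: (C2_directional2 oO C2).
have dl (t : R) : is_derive t 1 (fun s => l * s) l.
  by apply: is_derive_eq; rewrite /GRing.scale /=; ring.
have FE : F = (g + (g \o -%R)) - ((2 * m) \*: (cos \o (fun s => l * s))).
  by apply/funext.
have F'E : F' = (G - (G \o -%R)) + ((2 * m * l) \*: (sin \o (fun s => l * s))).
  by apply/funext.
have Onear : \forall t \near (0 : R), Omega (x0 + t *: v) /\ Omega (x0 + (- t) *: v).
  by apply: line; exact: open_nbhs_nbhs (conj oO Ox0).
apply: (@second_derive_le0 _ F F').
- near=> t; have [Ot ONt] : Omega (x0 + t *: v) /\ Omega (x0 + (- t) *: v).
    by near: t.
  have dgN := is_derive1_comp (dg _ ONt) (is_deriveNid (t : R) (1 : R)).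
  have dc := is_derive1_comp (is_derive_cos (l * t)) (dl t).
  rewrite FE; apply: (is_derive_eq
    (is_deriveB (is_deriveD (dg _ Ot) dgN) (is_deriveZ (2 * m) dc))).
  by rewrite /F' /GRing.scale /=; ring.
- by rewrite /F' oppr0 subrr mulr0 sin0 mulr0 addr0.
- have dG0 : is_derive (- 0 : R) 1 G (bform H v v) by rewrite oppr0.
  have dGN := is_derive1_comp dG0 (is_deriveNid (0 : R) (1 : R)).
  have ds := is_derive1_comp (is_derive_sin (l * 0)) (dl 0).
  rewrite F'E; apply: (is_derive_eq
    (is_deriveD (is_deriveB dG dGN) (is_deriveZ (2 * m * l) ds))).
  by rewrite /GRing.scale /= mulr0 cos0; ring.
near=> t.
have [t1 t2] : radial_cos k x0 - psi x0 <= radial_cos k (x0 + t *: v) - psi (x0 + t *: v) /\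
  radial_cos k x0 - psi x0 <= radial_cos k (x0 + (- t) *: v) - psi (x0 + (- t) *: v).
  by near: t; exact: (line _ touch).
(* For such [t] the term [|t| l] stays below [pi / 2], as does [k |x0|], so the midpoint lemma
   applies. *)
have tl : `|t| < pi / 2 / (1 + l).
  near: t; apply/(@nbhs_norm0P R R^o); exists (pi / 2 / (1 + l)) => //=.
  by rewrite !divr_gt0 ?pi_gt0// ltr_pwDl.
have := @radial_cos_midpoint k x0 v t k0.
rewrite -/l -/m => mid; have {mid}mid := mid _.
move: t1 t2; rewrite -/m /F /g oppr0 scale0r addr0 mulr0 cos0 mulr1 [l * t]mulrC.
suff : k * Num.sqrt (dot x0 x0) + `|t| * l <= pi by move=> /mid; lra.
have -> : pi = pi / 2 + pi / 2 :> R by rewrite -splitr.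
rewrite lerD ?(ltW (Ok _ Ox0))//.
apply: le_trans (_ : `|t| * (1 + l) <= _); first by rewrite ler_wpM2l// lerDr.
by rewrite -ler_pdivlMr ?ltW// ltr_pwDl.
Unshelve. all: by end_near. Qed.

End ball_supersolution.

(** * Comparison along a segment *)

Section smooth_test_functions.
Context {R : realType} {N : nat}.
Implicit Types (f g : 'rV[R]_N -> R) (x v w : 'rV[R]_N).

Definition C1fun f := forall x, {for x, continuous f} /\
  forall j, derivable f x (basis_vec j) /\ {for x, continuous (partial j f)}.

(** Layering [C1fun] lets the sum, product and scaling rules be applied a second time to the partial
    derivatives. *)
Definition C2fun f := C1fun f /\ forall j, C1fun (partial j f).

Lemma C2fun_C2_on (Omega : set 'rV[R]_N) f : C2fun f -> C2_on Omega f.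
Proof.
move=> [f1 f2] x _; have [cf df] := f1 x; split=> // j.
have [dj cj] := df j; split=> // i; exact: (f2 j x).2.
Qed.

Lemma C1fun_cont f : C1fun f -> continuous f.
Proof. by move=> f1 x; have [] := f1 x. Qed.

Lemma C1fun_derive f x j : C1fun f -> is_derive x (basis_vec j) f (partial j f x).
Proof. by move=> f1; apply/derivableP; have [_ /(_ j)[]] := f1 x. Qed.

Lemma C1fun_partial_cont f j : C1fun f -> continuous (partial j f).
Proof. by move=> f1 x; have [_ /(_ j)[]] := f1 x. Qed.

Lemma C1funI f (df : 'I_N -> 'rV[R]_N -> R) : continuous f ->
  (forall j x, is_derive x (basis_vec j) f (df j x)) ->
  (forall j, continuous (df j)) -> C1fun f /\ forall j, partial j f = df j.
Proof.
move=> cf fd cdf.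
have E j : partial j f = df j by apply/funext => x; have [_] := fd j x.
split=> // x; split; first exact: cf.
by move=> j; split; [have [] := fd j x|rewrite E; exact: cdf].
Qed.

Lemma C1funD f g : C1fun f -> C1fun g -> C1fun (f + g) /\
  forall j, partial j (f + g) = partial j f + partial j g.
Proof.
move=> f1 g1; apply: C1funI => [x|j x|j x].
- by apply: continuousD; exact: C1fun_cont.
- by apply: is_deriveD; exact: C1fun_derive.
- by apply: continuousD; exact: C1fun_partial_cont.
Qed.

Lemma C1funM f g : C1fun f -> C1fun g -> C1fun (f * g) /\
  forall j, partial j (f * g) = f * partial j g + g * partial j f.
Proof.
move=> f1 g1; apply: C1funI => [x|j x|j x].
- by apply: continuousM; exact: C1fun_cont.
- by apply: is_deriveM; exact: C1fun_derive.
- apply: continuousD; apply: continuousM.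
  + exact: (C1fun_cont f1).
  + exact: (C1fun_partial_cont g1).
  + exact: (C1fun_cont g1).
  + exact: (C1fun_partial_cont f1).
Qed.

Lemma C2funM f g : C2fun f -> C2fun g -> C2fun (f * g).
Proof.
move=> [f1 f2] [g1 g2]; have [fg E] := C1funM f1 g1.
split; first exact: fg.
move=> j; rewrite E.
exact: (C1funD (C1funM f1 (g2 j)).1 (C1funM g1 (f2 j)).1).1.
Qed.

Lemma C1funZ (c : R) f : C1fun f -> C1fun (c \*: f) /\
  forall j, partial j (c \*: f) = c \*: partial j f.
Proof.
move=> f1; apply: (@C1funI _ (fun j => c \*: partial j f)) => [x|j x|j x].
- by apply: continuousZl_tmp; exact: C1fun_cont.
- by apply: is_deriveZ; exact: C1fun_derive.
- by apply: continuousZl_tmp; exact: C1fun_partial_cont.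
Qed.

Lemma C2funZ (c : R) f : C2fun f -> C2fun (c \*: f).
Proof.
move=> [f1 f2]; have [cf E] := C1funZ c f1.
split; first exact: cf.
move=> j; rewrite E.
exact: (C1funZ c (f2 j)).1.
Qed.

(** The phase [c] closes the family under differentiation: each derivative is a multiple of the same
    wave with phase advanced by [pi / 2]. *)
Definition plane_cos w (c : R) x := cos (dot x w + c).

Lemma dotDl x v w : dot (x + v) w = dot x w + dot v w.
Proof. by rewrite !dotE bformDl. Qed.

Lemma dotZl (a : R) x w : dot (a *: x) w = a * dot x w.
Proof. by rewrite !dotE bformZl. Qed.

Lemma dotl_continuous w : continuous (fun x => dot x w).
Proof.
move=> x; rewrite (_ : (fun x => _) = fun y => \sum_i y 0 i * w 0 i).
  apply: (@cvg_sum_real _ _ _ (nbhs x)) => i.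
  by apply: cvgM; [exact: coord_continuous|exact: cvg_cst].
by apply/funext => y; exact: dot_sum.
Qed.

Lemma plane_cos_continuous w c : continuous (plane_cos w c).
Proof.
move=> x; have c1 : {for x, continuous (fun x => dot x w + c)}.
  by apply: (@continuousD _ _ _ _ (fun=> c)); [exact: dotl_continuous|exact: cst_continuous].
apply: (@continuous_comp _ _ _ _ cos _ c1); exact: continuous_cos.
Qed.

Lemma is_derive_affine_cos (p q t : R) :
  is_derive t 1 (fun s => cos (p + s * q)) (q * cos (p + t * q + pi / 2)).
Proof.
have d1 : is_derive t 1 (fun s => p + s * q) q.
  by apply: is_derive_eq; rewrite /GRing.scale /=; ring.
apply: (is_derive_eq (is_derive1_comp (is_derive_cos _) d1)).
by rewrite cosDpihalf mulrC.
Qed.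

Lemma is_derive_plane_cos w c x v : is_derive x v (plane_cos w c)
  (dot v w * plane_cos w (c + pi / 2) x).
Proof.
rewrite -[x in is_derive x](addr0) -(scale0r v).
apply/(@is_derive_lineP _ _ (plane_cos w c) x v 0).
have := is_derive_affine_cos (dot x w + c) (dot v w) 0.
rewrite mul0r addr0 /plane_cos addrA.
congr (is_derive _ _ _ _); apply/funext => s.
by rewrite dotDl dotZl addrAC.
Qed.

Lemma plane_cos_C1 w c : C1fun (plane_cos w c) /\
  forall j, partial j (plane_cos w c) =
    dot (basis_vec j) w \*: plane_cos w (c + pi / 2).
Proof.
apply: (@C1funI _ (fun j => dot (basis_vec j) w \*: plane_cos w (c + pi / 2)))
  => [|j x|j x]; first exact: plane_cos_continuous.
  exact: is_derive_plane_cos.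
by apply: continuousZl_tmp; exact: plane_cos_continuous.
Qed.

Lemma plane_cos_C2 w c : C2fun (plane_cos w c).
Proof.
split; first exact: (plane_cos_C1 w c).1.
move=> j; rewrite (plane_cos_C1 w c).2.
exact: (C1funZ _ (plane_cos_C1 _ _).1).1.
Qed.

Lemma plane_cos_prod_C2 (I : Type) (r : seq I) (w : I -> 'rV[R]_N) :
  C2fun (\prod_(i <- r) plane_cos (w i) 0).
Proof.
elim: r => [|i r IH]; last first.
  rewrite big_cons; exact: (C2funM (plane_cos_C2 (w i) 0) IH).
rewrite big_nil (_ : 1 = plane_cos 0 0); first exact: plane_cos_C2.
by apply/funext => x; rewrite /plane_cos /dot trmx0 mulmx0 mxE addr0 cos0.
Qed.

(** As [C] is constant along [v], both derivatives fall on the cosine; two phase shifts of [pi / 2]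
    change its sign. *)
Lemma hessian_plane_cosM (w v : 'rV[R]_N) (C : 'rV[R]_N -> R) x :
  C2fun C -> (forall y (s : R), C (y + s *: v) = C y) ->
  bform (hessian (plane_cos w 0 * C) x) v v =
  - (dot v w) ^+ 2 * (plane_cos w 0 * C) x.
Proof.
move=> C2 Cv; set psi := _ * C.
have psi2 : C2_on setT psi.
  exact: (C2fun_C2_on (C2funM (plane_cos_C2 w 0) C2)).
have dC y : is_derive y v C 0.
  rewrite -[y in is_derive y]addr0 -(scale0r v).
  apply/(@is_derive_lineP _ _ C y v 0).
  rewrite (_ : (fun s => _) = cst (C y)); last by apply/funext => s; rewrite Cv.
  exact: is_derive_cst.
have dM c y : is_derive y v (plane_cos w c * C)
    (dot v w * (plane_cos w (c + pi / 2) * C) y).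
  apply: (is_derive_eq (is_deriveM (is_derive_plane_cos w c y v) (dC y))).
  by rewrite /GRing.scale /= mulr0 add0r mulrCA [C y * _]mulrC.
have E : (fun y => \sum_j v 0 j * partial j psi y) =
    dot v w \*: (plane_cos w (0 + pi / 2) * C).
  apply/funext => y.
  have [_ <-] := strict_derive_is_derive (C2_strict openT psi2 v (I : setT y)).
  by have [_ ->] := dM 0 y.
have := C2_directional2 openT psi2 v (I : setT x).
rewrite E => -[_ <-].
have [_ ->] := is_deriveZ (dot v w) (dM (0 + pi / 2) x).
rewrite -[LHS]/(dot v w * (dot v w *
  (cos (dot x w + (0 + pi / 2 + pi / 2)) * C x))).
rewrite -[RHS]/(- dot v w ^+ 2 * (cos (dot x w + 0) * C x)).
by rewrite add0r addr0 addrA cosDpihalf sinDpihalf; ring.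
Qed.

End smooth_test_functions.

(** The superlevel sets [B z] are nested, so they generate a proper filter, which clusters at some
    [x] in [K]. If [f x < f z], semicontinuity would give a neighbourhood of [x] missing [B z]. *)
Lemma compact_usc_max {T : topologicalType} {R : realType} (K : set T)
    (f : T -> R) : compact K -> K !=set0 ->
  (forall x a, K x -> f x < a -> \forall y \near x, K y -> f y < a) ->
  exists2 x, K x & forall y, K y -> f y <= f x.
Proof.
move=> cK [k Kk] usc.
pose B z := [set x | K x /\ f z <= f x].
have FF : ProperFilter (filter_from K B).
  apply: filter_from_proper; last by move=> z Kz; exists z; split.
  apply: filter_from_filter; first by exists k.
  move=> i j Ki Kj; have [ij|ji] := leP (f i) (f j).
    by exists j => // x [Kx jx]; split; split=> //; exact: le_trans jx.
  by exists i => // x [Kx ix]; split; split=> //; exact: le_trans (ltW ji) ix.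
have FK : filter_from K B K by exists k => // x [].
have [x [Kx clx]] := cK _ FF FK.
exists x => // z Kz; rewrite leNgt; apply/negP => xz.
have Bz : filter_from K B (B z) by exists z.
have [y [[Ky zy] /(_ Ky)]] := clx _ _ Bz (usc x _ Kx xz).
by rewrite ltNge zy.
Qed.

Section upper_bound.
Context {R : realType} {N : nat}.
Implicit Types (x y v w : 'rV[R]_N).

Lemma near_dot_lt w x (c : R) : `|dot x w| < c -> \forall y \near x, `|dot y w| < c.
Proof.
move=> xc; have c1 : {for x, continuous (fun y => `|dot y w|)}.
  apply: (@continuous_comp _ _ _ (fun y => dot y w) (fun a : R => `|a|)).
    exact: (@dotl_continuous R N w).
  exact: norm_continuous.
have cn : nbhs `|dot x w| [set a : R | a < c].
  by apply: open_nbhs_nbhs; split => //; exact: open_lt.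
exact: (c1 _ cn).
Qed.

Lemma cos_itv_ge0 (t : R) : `|t| <= pi / 2 -> 0 <= cos t.
Proof. by rewrite ler_norml => ?; exact: cos_ge0_pihalf. Qed.

Lemma cos_itv_neq0 (t : R) : `|t| <= pi / 2 -> cos t != 0 -> `|t| < pi / 2.
Proof.
rewrite le_eqVlt => /orP[/eqP tpi|//].
by rewrite -cos_norm tpi cos_pihalf eqxx.
Qed.

(* On [K] the nonnegative test function
   [cos <x, w0> * \prod_i cos <x, w i>] vanishes exactly on the boundary, so the
   maximum of its quotient by the supersolution is interior; along [d] only the
   first factor varies. *)
Lemma admissible_strip_le (Omega : set 'rV[R]_N) (mu : R) (d w0 : 'rV[R]_N)
    (w : 'I_N -> 'rV[R]_N) : (0 < N)%N -> open Omega ->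
  let K := [set x | `|dot x w0| <= pi / 2 /\ forall i, `|dot x (w i)| <= pi / 2] in
  compact K -> K `<=` Omega -> (forall i, dot d (w i) = 0) ->
  admissible Omega mu -> mu * dot d d <= dot d w0 ^+ 2.
Proof.
move=> N0 oO K cK KO dw [phi [lsc pos visc]].
pose P := \prod_(i < N) plane_cos (w i) 0.
pose psi := plane_cos w0 0 * P.
have PE x : P x = \prod_(i < N) cos (dot x (w i)).
  by rewrite /P fct_prodE; apply: eq_bigr => i _; rewrite /plane_cos addr0.
have psiE x : psi x = cos (dot x w0) * \prod_(i < N) cos (dot x (w i)).
  by rewrite -PE -[LHS]/(cos (dot x w0 + 0) * P x) addr0.
have P2 : C2fun P by exact: plane_cos_prod_C2.
have psi_cont : continuous psi.
  exact: (C1fun_cont (C2funM (plane_cos_C2 w0 0) P2).1).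
have psi0 x : K x -> 0 <= psi x.
  move=> [K0 Ki]; rewrite psiE mulr_ge0 ?cos_itv_ge0//.
  by apply: prodr_ge0 => i _; rewrite cos_itv_ge0.
have dot0 u : dot 0 u = 0 :> R by rewrite /dot mul0mx mxE.
have pi20 : 0 <= pi / 2 :> R by rewrite divr_ge0// pi_ge0.
have K0 : K 0 by split=> [|i]; rewrite dot0 normr0.
have [|x a Kx xa|x0 Kx0 x0max] := @compact_usc_max _ _ K (fun x => psi x / phi x) cK.
- by exists 0.
- have Ox := KO _ Kx; have phix := pos _ Ox.
  have a0 : 0 < a by apply: le_lt_trans xa; rewrite divr_ge0 ?psi0 ?ltW.
  (* A value [c] strictly between [psi x / a] and [phi x] separates the two: near [x], [c < phi] by
     lower semicontinuity and [psi < a * c] by continuity, so the quotient stays below [a]. *)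
  have pa : psi x / a < phi x by rewrite ltr_pdivrMr// mulrC -ltr_pdivrMr.
  have [c1 c2] := midf_lt pa; set c := (_ / 2) in c1 c2.
  have [|V Vx HV] := lsc x c; first by rewrite /= lte_fin.
  have {}Vx : \forall y \near x, Omega y -> V y.
    have : within Omega (nbhs x) V by rewrite (nbhs_subspace_in Ox); exact: Vx.
    exact.
  have pc : \forall y \near x, psi y < a * c.
    have pn : nbhs (psi x) [set b : R | b < a * c].
      apply: open_nbhs_nbhs; split; first exact: open_lt.
      by rewrite /= mulrC -ltr_pdivrMr.
    exact: (psi_cont x _ pn).
  near=> y => Ky; have Oy := KO _ Ky.
  have yc : c < phi y.
    rewrite -lte_fin; apply: HV; have : Omega y -> V y by near: y.
    exact.
  rewrite ltr_pdivrMr ?pos//; apply: lt_trans (_ : a * c < _); first by near: y.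
  by rewrite ltr_pM2l.
have phi0 : 0 < phi x0 by apply: pos; exact: KO.
(* The origin lies in [K] and [psi] equals 1 there, so the maximal quotient is positive. *)
have psix0 : 0 < psi x0.
  have := x0max _ K0; rewrite psiE dot0 cos0 mul1r big1 => [|i _]; last first.
    by rewrite dot0 cos0.
  move=> h; rewrite -(pmulr_lgt0 _ (_ : 0 < (phi x0)^-1)) ?invr_gt0//.
  by apply: lt_le_trans h; rewrite mul1r invr_gt0 pos//; exact: KO.
(* The multiple of [psi] that touches [phi] from below at [x0]. *)
pose eta := phi x0 / psi x0.
have eta0 : 0 < eta by rewrite divr_gt0.
pose test := plane_cos w0 0 * (eta \*: P).
have testE y : test y = eta * psi y.
  by rewrite /psi -[LHS]/(plane_cos w0 0 y * (eta * P y)) mulrCA.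
have eP2 : C2fun (eta \*: P) by exact: C2funZ.
have test2 : C2_on Omega test by exact: (C2fun_C2_on (C2funM (plane_cos_C2 w0 0) eP2)).
have ePd y (s : R) : (eta \*: P) (y + s *: d) = (eta \*: P) y.
  rewrite -[LHS]/(eta * P (y + s *: d)) -[RHS]/(eta * P y) !PE; congr (_ * _).
  by apply: eq_bigr => i _; rewrite dotDl dotZl dw mulr0 addr0.
have hess := hessian_plane_cosM w0 x0 eP2 ePd.
have testx0 : test x0 = phi x0 by rewrite testE /eta divfK// gt_eqF.
(* Since [psi x0] is nonzero, no cosine factor vanishes, so every constraint defining [K] is strict
   at [x0] and persists nearby. *)
have nearK : \forall y \near x0, K y.
  have [K1 K2] := Kx0.
  move: (psix0); rewrite psiE => /lt0r_neq0; rewrite mulf_eq0 negb_or.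
  move=> /andP[n0 /prodf_neq0 ni].
  have near0 : \forall y \near x0, `|dot y w0| < pi / 2.
    by apply: near_dot_lt; exact: cos_itv_neq0.
  have neari : \forall y \near x0, forall i, `|dot y (w i)| < pi / 2.
    apply: (@filter_forall _ _ (fun i y => `|dot y (w i)| < pi / 2) (nbhs x0)) => i.
    by apply: near_dot_lt; exact: cos_itv_neq0 (ni i isT).
  near=> y; split=> [|i]; apply: ltW; first by near: y.
  by move: i; near: y.
have touch : \forall y \near x0, phi x0 - test x0 <= phi y - test y.
  near=> y; have Ky : K y by near: y.
  rewrite testx0 subrr subr_ge0 testE /eta mulrAC ler_pdivrMr//.
  have := x0max y Ky.
  rewrite ler_pdivrMr ?pos//; last exact: KO.
  by rewrite mulrAC ler_pdivlMr// mulrC [psi x0 * _]mulrC.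
have Ox0 := KO _ Kx0.
have P1 := visc test x0 test2 Ox0 touch.
have sym := hessian_sym oO test2 Ox0.
(* Testing the largest eigenvalue in the direction [d] gives [- (dot d w0)^2 * phi x0 <= P1plus *
   dot d d], to be combined with the viscosity inequality. *)
have ray := P1plus_ge d N0 sym.
rewrite hess -/test testx0 in ray.
rewrite -(ler_pM2r phi0).
have dd := dotvv_ge0 d.
have : (P1plus (hessian test x0) + mu * phi x0) * dot d d <= 0.
  by rewrite mulr_le0_ge0.
rewrite mulrDl; move: ray; lra.
Unshelve. all: by end_near. Qed.

End upper_bound.

(** * Boxes *)

Section boxes.
Context {R : realType} {N : nat}.
Implicit Types (x : 'rV[R]_N) (d : 'I_N -> R).

(** Parametrized by half-widths, so that [Rect] and [Cube] are both instances by conversion. *)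
Definition box d : set 'rV[R]_N := [set x | forall i, - d i < x 0 i < d i].

Lemma dot_basis_vec x i : dot x (basis_vec i) = x 0 i.
Proof.
rewrite dot_sum (bigD1 i)//= big1 => [|j /negbTE ji].
  by rewrite !mxE !eqxx mulr1 addr0.
by rewrite mxE ji andbF mulr0.
Qed.

Lemma open_box d : open (box d).
Proof.
rewrite openE => x bx; rewrite /interior.
have bi i : `|dot x (basis_vec i)| < d i by rewrite dot_basis_vec ltr_norml.
have : \forall y \near x, forall i, `|dot y (basis_vec i)| < d i.
  apply: (@filter_forall _ _ (fun i y => `|dot y (basis_vec i)| < d i) (nbhs x)).
  by move=> i; exact: near_dot_lt.
apply: filterS => y yb i; have := yb i.
by rewrite dot_basis_vec ltr_norml.
Qed.

Lemma closed_dot_le (w : 'rV[R]_N) (c : R) : closed [set x | `|dot x w| <= c].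
Proof.
apply: (@closed_comp _ _ (fun x : 'rV[R]_N => `|dot x w|) [set t | t <= c]).
  move=> x _; apply: (@continuous_comp _ _ _ (fun y => dot y w) (fun a : R => `|a|)).
    exact: (@dotl_continuous R N w).
  exact: norm_continuous.
exact: closed_le.
Qed.

(** The strip runs along the half-diagonal [D]. A frequency [k > pi / 2] ends it before the corners,
    which leaves room for a compact strip inside the open box; the bound follows as [k] tends to
    [pi / 2]. *)
Lemma box_admissible_le d mu : (0 < N)%N -> (forall i, 0 < d i) ->
  admissible (box d) mu -> mu <= (pi / 2) ^+ 2 / \sum_i d i ^+ 2.
Proof.
move=> N0 d0 adm; pose i0 := Ordinal N0.
pose D : 'rV[R]_N := \row_i d i.
have DD : dot D D = \sum_i d i ^+ 2.
  by rewrite dot_sum; apply: eq_bigr => i _; rewrite !mxE expr2.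
have DD0 : 0 < dot D D.
  rewrite lt_neqAle dotvv_ge0 eq_sym dotvv_eq0 andbT; apply/eqP => /rowP/(_ i0).
  by rewrite !mxE => /eqP; rewrite gt_eqF.
rewrite -DD ler_pdivlMr//.
have pi2 : 0 < pi / 2 :> R by rewrite divr_gt0// pi_gt0.
suff key k : pi / 2 < k -> mu * dot D D <= k ^+ 2.
  have [//|lt] := leP (mu * dot D D) ((pi / 2) ^+ 2).
  have mD0 : 0 <= mu * dot D D by apply: le_trans (ltW lt); exact: sqr_ge0.
  (* If the bound failed, taking [k^2] halfway between the two sides would contradict [key]. *)
  pose m := ((pi / 2) ^+ 2 + mu * dot D D) / 2.
  have [m1 m2] : ((pi / 2) ^+ 2 < m) * (m < mu * dot D D) := midf_lt lt.
  have m0 : 0 <= m by apply: le_trans (ltW m1); exact: sqr_ge0.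
  have := key (Num.sqrt m).
  rewrite sqr_sqrtr// leNgt m2; apply; rewrite -(@ltr_pXn2r _ 2) ?nnegrE//.
    by rewrite sqr_sqrtr.
  exact: ltW.
move=> kpi; have k0 : 0 < k by exact: lt_trans kpi.
(* With [tau = x 0 i0 / d i0], equal to 1 at the corner [D], the first cosine vanishes at [tau = T],
   short of the corner. *)
pose T := pi / 2 / k.
have T0 : 0 < T by rewrite divr_gt0.
have T1 : T < 1 by rewrite ltr_pdivrMr// mul1r.
(* Half the room that remains in coordinate [i] at the end of the strip. *)
pose del i := (1 - T) * d i / 2.
have del0 i : 0 < del i by rewrite divr_gt0// mulr_gt0// subr_gt0.
pose w0 := (k / d i0) *: (basis_vec i0 : 'rV[R]_N).
(* This form measures the deviation of coordinate [i] from [d i * tau], so it vanishes on [D]; the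
   cosine reaches zero at deviation [del i]. For [i = i0] it is zero and the factor is 1. *)
pose w i := (pi / 2 / del i) *:
  ((basis_vec i : 'rV[R]_N) + (- (d i / d i0)) *: basis_vec i0).
have w0E x : dot x w0 = k * (x 0 i0 / d i0).
  by rewrite dotC dotZl dotC dot_basis_vec; ring.
have wE i x : dot x (w i) = pi / 2 / del i * (x 0 i - d i * (x 0 i0 / d i0)).
  by rewrite dotC dotZl dotDl dotZl ![dot _ x]dotC !dot_basis_vec; ring.
have d00 : d i0 != 0 by rewrite gt_eqF.
have -> : k ^+ 2 = dot D w0 ^+ 2 by rewrite w0E !mxE divff// mulr1.
pose K := [set x : 'rV[R]_N | `|dot x w0| <= pi / 2 /\ forall i, `|dot x (w i)| <= pi / 2].
have Kd x i : K x -> `|x 0 i| < d i.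
  move=> [x0 /(_ i) xi].
  have {}x0 : `|x 0 i0 / d i0| <= T.
    rewrite -(ler_pM2l k0) /T mulrCA divff ?gt_eqF// mulr1.
    by move: x0; rewrite w0E normrM gtr0_norm.
  have {}xi : `|x 0 i - d i * (x 0 i0 / d i0)| <= del i.
    have pd : 0 < pi / 2 / del i by rewrite divr_gt0.
    rewrite -(ler_pM2l pd) divfK ?gt_eqF//.
    by move: xi; rewrite wE normrM gtr0_norm.
  (* Deviation plus diagonal part: at most [del i + d i * T], which is [(1 + T) / 2] times [d i]. *)
  have -> : x 0 i = (x 0 i - d i * (x 0 i0 / d i0)) + d i * (x 0 i0 / d i0) by ring.
  apply: le_lt_trans (ler_normD _ _) _; rewrite normrM gtr0_norm//.
  apply: (@le_lt_trans _ _ (del i + d i * T)); first by rewrite lerD// ler_wpM2l// ltW.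
  have := del0 i; rewrite /del; lra.
apply: (@admissible_strip_le _ _ (box d) mu D w0 w N0 (@open_box d)) => //.
- apply: bounded_closed_compact.
    exists (\sum_i d i); split; first exact: num_real.
    move=> M M1 v Kv; apply: le_trans (ltW M1).
    rewrite [leLHS]/Num.Def.normr /= mx_normrE; apply/bigmax_leP; split => [|[j i] _ /=].
      by apply: sumr_ge0 => i _; rewrite ltW.
    rewrite ord1 (le_trans (ltW (Kd _ i Kv)))// (bigD1 i)//= lerDl.
    by apply: sumr_ge0 => l _; rewrite ltW.
  have -> : [set x : 'rV[R]_N | `|dot x w0| <= pi / 2 /\ forall i, `|dot x (w i)| <= pi / 2]
     = [set x | `|dot x w0| <= pi / 2] `&` \bigcap_i [set x | `|dot x (w i)| <= pi / 2].
    by apply/seteqP; split=> x [x0 xi]; split=> // i; [move=> _|]; exact: xi.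
  apply: closedI; first exact: closed_dot_le.
  by apply: closed_bigI => i _; exact: closed_dot_le.
- by move=> x /Kd Kx i; rewrite -ltr_norml.
- by move=> i; rewrite wE !mxE divff// mulr1 subrr mulr0.
Qed.

(** The open box lies in the open ball whose radius is the half-diagonal, and [k] is [pi / 2]
    divided by that radius. *)
Lemma box_admissible d : (0 < N)%N -> (forall i, 0 < d i) ->
  admissible (box d) ((pi / 2) ^+ 2 / \sum_i d i ^+ 2).
Proof.
move=> N0 d0; set S := \sum_i _.
have S0 : 0 < S.
  rewrite /S (bigD1 (Ordinal N0))//= ltr_pwDl ?exprn_gt0//.
  by apply: sumr_ge0 => i _; rewrite sqr_ge0.
have pi2 : 0 < pi / 2 :> R by rewrite divr_gt0// pi_gt0.
have sS : 0 < Num.sqrt S by rewrite sqrtr_gt0.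
have -> : (pi / 2) ^+ 2 / S = (pi / 2 / Num.sqrt S) ^+ 2.
  by rewrite [RHS]expr_div_n sqr_sqrtr// ltW.
apply: ball_admissible => //; first by rewrite ltW// divr_gt0.
  exact: open_box.
move=> x bx; rewrite mulrAC ltr_pdivrMr// ltr_pM2l// ltr_sqrt// dot_sum /S.
have bi i : x 0 i * x 0 i < d i ^+ 2.
  rewrite -expr2 -real_normK ?num_real//.
  by rewrite ltr_pXn2r ?nnegrE ?normr_ge0 ?(ltW (d0 i))// ltr_norml.
rewrite (bigD1 (Ordinal N0))//= [ltRHS](bigD1 (Ordinal N0))//=.
by rewrite ltr_leD// ler_sum// => i _; rewrite ltW.
Qed.

(** The sum is the square of half the diameter, so the value is [(pi / diameter)^2]. *)
Lemma mu1plus_box d : (0 < N)%N -> (forall i, 0 < d i) ->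
  mu1plus (box d) = ((pi / 2) ^+ 2 / \sum_i d i ^+ 2)%:E.
Proof.
move=> N0 d0; apply/eqP; rewrite eq_le; apply/andP; split.
  by apply: ge_ereal_sup => _ [mu adm <-]; rewrite lee_fin box_admissible_le.
by apply: ereal_sup_ubound; exists ((pi / 2) ^+ 2 / \sum_i d i ^+ 2) => //; exact: box_admissible.
Qed.

End boxes.

(** * Volume of a box *)

Section lebesgue_box.
Context {R : realType}.

(** [lebesgue_tuple] is a bare set function, so its value on empty slices is computed by
    induction. *)
Lemma lebesgue_tuple0 n : @lebesgue_tuple R n set0 = 0%E.
Proof.
elim: n => [|n IH] /=; first by rewrite diracE in_set0.
rewrite /pushforward preimage_set0 /product_measure1.
under eq_integral do rewrite /= xsection0 IH.
exact: integral0.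
Qed.

(** Slicing by the first coordinate: the section is a lower-dimensional box when that coordinate is
    in range and empty otherwise, so the integrand is constant on an interval. *)
Lemma lebesgue_tuple_box n (d : 'I_n -> R) : (forall i, 0 < d i) ->
  lebesgue_tuple [set t : n.-tuple R | forall i, - d i < tnth t i < d i] =
  (\prod_i (2 * d i))%:E.
Proof.
elim: n d => [|n IH] d d0 /=.
  by rewrite diracE big_ord0 mem_set// => -[].
rewrite /pushforward /product_measure1.
pose I : set R := `]- d ord0, d ord0[%classic.
pose c := \prod_(i < n) (2 * d (lift ord0 i)).
transitivity (\int[@lebesgue_measure R]_x ((cst c%:E) \_ I) x)%E.
  apply: eq_integral => x _; rewrite /= patchE.
  case: ifPn => xI.
    rewrite -(IH (fun i => d (lift ord0 i)))//; congr lebesgue_tuple.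
    apply/seteqP; split=> t.
      rewrite /xsection /= inE /= => H i.
      by have := H (lift ord0 i); rewrite tnthS.
    rewrite /xsection /= inE /= => H i.
    have [->|[j ->]] : i = ord0 \/ exists j, i = lift ord0 j.
      by case: (unliftP ord0 i) => [j ->|->]; [right; exists j|left].
      by move: xI; rewrite inE /I /= in_itv /= tnth0.
    by rewrite tnthS.
  rewrite -[RHS](lebesgue_tuple0 n); congr lebesgue_tuple.
  apply/seteqP; split=> t //.
  rewrite /xsection /= inE /= => /(_ ord0).
  rewrite tnth0 => xI'; move/negP: xI; apply.
  by rewrite inE /I /= in_itv.
rewrite -integral_mkcond integral_cst//=; last exact: measurable_itv.
rewrite lebesgue_measure_itv /= lte_fin.
have dd : - d ord0 < d ord0 by rewrite -subr_gt0 opprK addr_gt0.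
rewrite dd -EFinD -EFinM big_ord_recl /= mulrC; congr (_ * _)%:E; ring.
Qed.

Lemma lebesgue_rV_box n (d : 'I_n -> R) : (forall i, 0 < d i) ->
  lebesgue_rV (box d) = (\prod_i (2 * d i))%:E.
Proof.
move=> d0; rewrite -lebesgue_tuple_box// /lebesgue_rV; congr lebesgue_tuple.
by apply/seteqP; split=> t /= H i; have := H i; rewrite mxE.
Qed.

End lebesgue_box.

(** AM-GM for the squares, whose product is again 1. It compares powers of exponent [N.+1], so the
    root is taken by monotonicity; dimension 0 is separate. *)
Lemma sum_sqr_ge_AGM {R : realFieldType} (N : nat) (b : 'I_N -> R) :
  (forall i, 0 <= b i) -> \prod_i b i = 1 -> N%:R <= \sum_i b i ^+ 2.
Proof.
case: N b => [|N] b b0 b1; first by rewrite big_ord0.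
have b20 : {in 'I_N.+1, forall i, 0 <= b i ^+ 2} by move=> i _; exact: sqr_ge0.
have [+ _] := leif_AGM b20; rewrite prodrXl b1 expr1n card_ord.
rewrite -[X in X <= _](expr1n _ N.+1) ler_pXn2r ?nnegrE//; last first.
  by rewrite divr_ge0// sumr_ge0.
by rewrite ler_pdivlMr ?ltr0n// mul1r.
Qed.

Theorem mainTheorem1 (R : realType) (N : nat) (hN : (2 <= N)%N)
    (r : R) (hr : 0 < r) (alpha : 'I_N -> R) (halpha : forall i, 0 < alpha i) :
  (lebesgue_rV (Rect r alpha) = lebesgue_rV (@Cube R N r)
     <-> \prod_(i < N) alpha i = 1) /\
  (lebesgue_rV (Rect r alpha) = lebesgue_rV (@Cube R N r) ->
     (mu1plus (Rect r alpha) <= mu1plus (@Cube R N r))%E).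
Proof.
have N0 : (0 < N)%N by exact: ltnW.
have ar0 i : 0 < (alpha i)^-1 * r by rewrite mulr_gt0// invr_gt0.
have r0 (i : 'I_N) : 0 < r by [].
have volE : lebesgue_rV (Rect r alpha) = lebesgue_rV (@Cube R N r)
    <-> \prod_(i < N) alpha i = 1.
  rewrite -[Rect r alpha]/(box (fun i => (alpha i)^-1 * r)).
  rewrite -[@Cube R N r]/(box (fun _ : 'I_N => r)) !lebesgue_rV_box//.
  have -> : \prod_(i < N) (2 * ((alpha i)^-1 * r)) =
      (\prod_(i < N) alpha i)^-1 * \prod_(i < N) (2 * r).
    by rewrite -prodfV -big_split; apply: eq_bigr => i _ /=; rewrite mulrCA.
  have c0 : \prod_(i < N) (2 * r) != 0.
    by apply/prodf_neq0 => i _; rewrite gt_eqF// mulr_gt0.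
  split=> [[/(canRL (mulfK c0))]|->]; last by rewrite invr1 mul1r.
  by rewrite divff// => /(canRL invrK); rewrite invr1.
split=> // /volE a1.
rewrite -[Rect r alpha]/(box (fun i => (alpha i)^-1 * r)).
rewrite -[@Cube R N r]/(box (fun _ : 'I_N => r)) !mu1plus_box// lee_fin.
have sq0 (d : 'I_N -> R) : (forall i, 0 < d i) -> 0 < \sum_i d i ^+ 2.
  move=> d0; rewrite (bigD1 (Ordinal N0))//= ltr_pwDl ?exprn_gt0//.
  by rewrite sumr_ge0// => i _; rewrite sqr_ge0.
(* The eigenvalue decreases in the squared half-diagonal, so it remains to compare [N * r^2] with
   the sum of [(alpha i)^-2 * r^2], which is AM-GM for the inverses of [alpha]. *)
rewrite ler_wpM2l ?sqr_ge0// lef_pV2 ?posrE; [|exact: sq0|exact: sq0].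
rewrite sumr_const card_ord -[X in X <= _]mulr_natl.
rewrite (eq_bigr (fun i => (alpha i)^-1 ^+ 2 * r ^+ 2)); last first.
  by move=> i _; rewrite exprMn.
rewrite -mulr_suml ler_wpM2r ?sqr_ge0// sum_sqr_ge_AGM//.
  by move=> i; rewrite invr_ge0 ltW.
by rewrite prodfV a1 invr1.
Qed.
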